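(* Let $D$ be a diagram with $N$ crossings of an oriented knot $K\subset S^3$, and let $a=(a_1,\dots,a_N)$ be an arc-coloring of $D$ of sign-type $\epsilon=(\epsilon_1,\dots,\epsilon_N)\in\{\pm1\}^N$ whose associated representation $\rho_a:\pi_1(S^3\setminus K)\to SL_2(\mathbb C)$ is a (non-abelian) parabolic representation. Then the obstruction class of $\rho_a$ equals the total-sign of $\epsilon$, i.e. $\mathrm{ob}(\rho_a)=[\epsilon]=\epsilon_1\epsilon_2\cdots\epsilon_N\in\{\pm1\}$.
   Context: Diagram conventions: $K$ is an oriented knot in $S^3$, $G_K=\pi_1(S^3\setminus K)$, and $D$ is an oriented diagram of $K$ with $N$ crossings $c_1,\dots,c_N$ and $N$ arcs $\mathsf a_1,\dots,\mathsf a_N$ (an arc is a connected piece of $D$ between two consecutive under-crossings). The Wirtinger generator of $\mathsf a_i$ is denoted $m_i$. At a crossing with incoming under-arc $\mathsf a_i$, outgoing under-arc $\mathsf a_j$ and over-arc $\mathsf a_k$, the Wirtinger relation is $m_j=m_k^{-1}m_im_k$ if the crossing is positive and $m_j=m_km_im_k^{-1}$ if it is negative. A parabolic representation of $K$ is a non-abelian homomorphism $\rho:G_K\to SL_2(\mathbb C)$ with $\mathrm{tr}\,\rho(m)=2$ and $\rho(m)\ne I$ for every meridian $m$. For $b=\binom{x}{y}\in\mathbb C^2$ let $\mathcal M(b)=\begin{pmatrix}1-xy&x^2\\-y^2&1+xy\end{pmatrix}\in SL_2(\mathbb C)$. For $a,b\in\mathbb C^2$ put $a\triangleright b=\mathcal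 M(b)^{-1}a=a+\det(a,b)\,b$ and $a\triangleleft b=\mathcal M(b)a=a-\det(a,b)\,b$. An arc-coloring of $D$ of sign-type $\epsilon=(\epsilon_1,\dots,\epsilon_N)\in\{\pm1\}^N$ is a tuple $(a_1,\dots,a_N)\in(\mathbb C^2)^N$ (vector $a_i$ on arc $\mathsf a_i$) such that at each crossing $c_n$, with incoming under-arc $\mathsf a_i$, outgoing under-arc $\mathsf a_j$ and over-arc $\mathsf a_k$, $\epsilon_na_j=a_i\triangleright a_k$ if $c_n$ is positive and $\epsilon_na_j=a_i\triangleleft a_k$ if $c_n$ is negative. The associated representation $\rho_a$ is defined by $\rho_a(m_i)=\mathcal M(a_i)$ for all $i$. Obstruction class: for a parabolic $\rho:G_K\to SL_2(\mathbb C)$, $\mathrm{ob}(\rho)\in\{\pm1\}$ is the obstruction class to lifting the induced $PSL_2(\mathbb C)$-representation to a boundary-unipotent $SL_2(\mathbb C)$-representation (one with trace $2$ on all peripheral loops); it equals $\tfrac12\mathrm{tr}\,\rho(\lambda)$ for any longitude $\lambda$ of $K$. *)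

(* Defs.v *)
From HB Require Import structures.
From mathcomp Require Import all_boot all_order all_algebra all_fingroup.
From mathcomp Require Import generic_quotient.
From mathcomp Require Import boolp reals.
From mathcomp Require Import complex.
From mathcomp Require Import ring.

Set Implicit Arguments.
Unset Strict Implicit.
Unset Printing Implicit Defensive.

Import GRing.Theory.

Local Open Scope quotient_scope.
Local Open Scope group_scope.

(* Group presentations. A letter [(i, true)] stands for the i-th generator and
   [(i, false)] for its inverse; [r u v] is the defining relation [u = v]. *)
Section Presentation.

Variable I : choiceType.
Implicit Types (i : I) (u v w : seq (I * bool)) (r : seq (I * bool) -> seq (I * bool) -> Prop).

Inductive wcongr r : seq (I * bool) -> seq (I * bool) -> Prop :=
| Wrefl u : wcongr r u u
| Wsym u v : wcongr r u v -> wcongr r v u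
| Wtrans u v w : wcongr r u v -> wcongr r v w -> wcongr r u w
| Wcat u v u' v' : wcongr r u v -> wcongr r u' v' -> wcongr r (u ++ u') (v ++ v')
| Wcancel i b : wcongr r [:: (i, b); (i, ~~ b)] [::]
| Wrel u v : r u v -> wcongr r u v.

Definition wcongrb r u v : bool := `[< wcongr r u v >].

Lemma wcongrb_equiv r : equiv_class_of (wcongrb r).
Proof.
split.
- by move=> u; apply/asboolP; exact: Wrefl.
- by move=> u v; apply/asboolP/asboolP => /Wsym.
- by move=> v u w /asboolP uv /asboolP vw; apply/asboolP; exact: Wtrans vw.
Qed.

Canonical wcongrb_equiv_rel r := EquivRelPack (wcongrb_equiv r).

Definition presented r := {eq_quot wcongrb r}.

HB.instance Definition _ r := Choice.on (presented r).
HB.instance Definition _ r := EqQuotient.on (presented r).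

Definition wclass r w : presented r := \pi_(presented r) w.

Lemma wclass_eq r u v : wclass r u = wclass r v <-> wcongr r u v.
Proof. by split=> [/eqmodP/asboolP|uv]; last exact/eqmodP/asboolP. Qed.

Lemma wrepr r u : wcongr r (repr (wclass r u)) u.
Proof. by apply/wclass_eq; rewrite /wclass reprK. Qed.

Definition winv u := rev [seq (x.1, ~~ x.2) | x <- u].

Lemma winv_cat u v : winv (u ++ v) = winv v ++ winv u.
Proof. by rewrite /winv map_cat rev_cat. Qed.

Lemma winvK : involutive winv.
Proof.
move=> u; rewrite /winv map_rev revK -map_comp.
by rewrite -[RHS]map_id; apply: eq_map => -[i b] /=; rewrite negbK.
Qed.

Lemma winvl r u : wcongr r (winv u ++ u) [::].
Proof.
elim: u => [|[i b] u IH]; first exact: Wrefl.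
rewrite -cat1s winv_cat -catA [winv [:: _] ++ _]catA.
apply: Wtrans IH; apply: Wcat; first exact: Wrefl.
rewrite -[X in wcongr _ _ X]cat0s; apply: Wcat; last exact: Wrefl.
by rewrite /winv /= -{2}[b]negbK; exact: Wcancel.
Qed.

Lemma winvr r u : wcongr r (u ++ winv u) [::].
Proof. by rewrite -{1}[u]winvK; exact: winvl. Qed.

Lemma winv_congr r u v : wcongr r u v -> wcongr r (winv u) (winv v).
Proof.
move=> uv; apply: (@Wtrans _ _ (winv u ++ (v ++ winv v))).
  rewrite -[X in wcongr _ X _]cats0; apply: Wcat; first exact: Wrefl.
  exact/Wsym/winvr.
rewrite catA -[X in wcongr _ _ X]cat0s; apply: Wcat; last exact: Wrefl.
apply: Wtrans (winvl r u); apply: Wcat; [exact: Wrefl|exact: Wsym].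
Qed.

Definition pmul r (x y : presented r) := wclass r (repr x ++ repr y).
Definition pinv r (x : presented r) := wclass r (winv (repr x)).

Lemma wclass_repr r (x : presented r) : wclass r (repr x) = x.
Proof. exact: reprK. Qed.

Lemma pmulE r u v : pmul (wclass r u) (wclass r v) = wclass r (u ++ v).
Proof. by apply/wclass_eq/Wcat; exact: wrepr. Qed.

Lemma pinvE r u : pinv (wclass r u) = wclass r (winv u).
Proof. by apply/wclass_eq/winv_congr/wrepr. Qed.

Lemma pmulA r : associative (@pmul r).
Proof.
move=> x y z; rewrite -[x]wclass_repr -[y]wclass_repr -[z]wclass_repr.
by rewrite !pmulE catA.
Qed.

Lemma pmul1 r : left_id (wclass r [::]) (@pmul r).
Proof. by move=> x; rewrite -[x]wclass_repr pmulE. Qed.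

Lemma pmulr1 r : right_id (wclass r [::]) (@pmul r).
Proof. by move=> x; rewrite -[x]wclass_repr pmulE cats0. Qed.

Lemma pmulV r : left_inverse (wclass r [::]) (@pinv r) (@pmul r).
Proof.
by move=> x; rewrite -[x]wclass_repr pinvE pmulE; exact/wclass_eq/winvl.
Qed.

Lemma pmulrV r : right_inverse (wclass r [::]) (@pinv r) (@pmul r).
Proof.
by move=> x; rewrite -[x]wclass_repr pinvE pmulE; exact/wclass_eq/winvr.
Qed.

HB.instance Definition _ r := isGroup.Build (presented r)
  (@pmulA r) (@pmul1 r) (@pmulr1 r) (@pmulV r) (@pmulrV r).

Definition pgen r i : presented r := wclass r [:: (i, true)].

Section Lift.

Variables (H : groupType) (f : I -> H).

Definition weval (w : seq (I * bool)) : H :=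
  \prod_(x <- w) (if x.2 then f x.1 else (f x.1)^-1).

Definition respects r := forall u v, r u v -> weval u = weval v.

Lemma weval_cat u v : weval (u ++ v) = weval u * weval v.
Proof. by rewrite /weval big_cat. Qed.

Lemma weval_congr r u v : respects r -> wcongr r u v -> weval u = weval v.
Proof.
move=> fr; elim=> {u v} //.
- by move=> u v w _ -> _ ->.
- by move=> u v u' v' _ e _ e'; rewrite !weval_cat e e'.
- move=> i b; rewrite /weval !big_cons big_nil mulg1 /=.
  by case: b; rewrite ?mulgV ?mulVg.
Qed.

Definition plift r (fr : respects r) (x : presented r) : H := weval (repr x).

Lemma plift_wclass r (fr : respects r) w : plift fr (wclass r w) = weval w.
Proof. exact: weval_congr fr (wrepr _ _). Qed.

Lemma plift_gen r (fr : respects r) i : plift fr (pgen r i) = f i.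
Proof. by rewrite plift_wclass /weval big_cons big_nil mulg1. Qed.

Lemma pliftM r (fr : respects r) : {morph plift fr : x y / x * y}.
Proof.
move=> x y; rewrite -[x]wclass_repr -[y]wclass_repr.
by rewrite [_ * _]pmulE !plift_wclass weval_cat.
Qed.

Lemma plift1 r (fr : respects r) : plift fr 1 = 1.
Proof. by rewrite [1]/(wclass r [::]) plift_wclass /weval big_nil. Qed.

HB.instance Definition _ r (fr : respects r) :=
  isMultiplicative.Build _ _ (plift fr) (pliftM fr).
HB.instance Definition _ r (fr : respects r) :=
  Multiplicative_isUMagmaMorphism.Build _ _ (plift fr) (plift1 fr).

End Lift.

End Presentation.

(* Oriented knot diagrams, as planar signed Gauss codes.
   A knot diagram passes through each of its N crossings twice: (c, true) is
   the over-passage at c and (c, false) the under-passage, and [next] is the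
   order in which the oriented knot visits the 2N passages. An edge of the
   diagram (joining consecutive passages) is named after the passage it leaves.

   A half-edge (p, true) leaves the passage p and (p, false) enters it.
   [opposite] exchanges the two ends of an edge, and [ccw] sends a half-edge to
   the next one counterclockwise around its crossing. At a positive crossing
   the counterclockwise order is over-out, under-out, over-in, under-in; at a
   negative one it is over-out, under-in, over-in, under-out. *)
Section GaussCode.

Variables (N : nat) (next : {perm 'I_N * bool}) (positive : 'I_N -> bool).

Definition opposite (h : 'I_N * bool * bool) : 'I_N * bool * bool :=
  if h.2 then (next h.1, false) else (next^-1 h.1, true).

Definition ccw (h : 'I_N * bool * bool) : 'I_N * bool * bool :=
  let: (c, over, out) := h in
  (c, ~~ over, if positive c == over then out else ~~ out).

(* The faces are the orbits of [ccw \o opposite]. With N vertices and 2N edges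
   the connected closed surface carrying the diagram is a sphere iff there are
   N + 2 of them; in particular this forces N > 0. *)
Definition planar := fcard (ccw \o opposite) predT = N.+2.

End GaussCode.

Record diagram (N : nat) := Diagram {
  next : {perm 'I_N * bool};
  positive : 'I_N -> bool;
  (* the arc containing an edge *)
  arc : 'I_N * bool -> 'I_N;
  next_cycle : forall p q, fconnect next p q;
  diagram_planar : planar next positive;
  arc_over : forall c, arc (c, true) = arc (next^-1 (c, true));
  arc_under : injective (fun c => arc (c, false))
}.

Section Diagram.

Variables (N : nat) (D : diagram N).
Implicit Types (c : 'I_N) (p : 'I_N * bool).

Definition over_arc c : 'I_N := arc D (c, true).
Definition under_in c : 'I_N := arc D ((next D)^-1 (c, false)).
Definition under_out c : 'I_N := arc D (c, false).

Definition wirtinger (u v : seq ('I_N * bool)) : Prop :=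
  exists c, u = [:: (under_out c, true)] /\
    v = if positive D c
        then [:: (over_arc c, false); (under_in c, true); (over_arc c, true)]
        else [:: (over_arc c, true); (under_in c, true); (over_arc c, false)].

Definition knot_group : groupType := presented wirtinger.

Definition wgen (i : 'I_N) : knot_group := pgen wirtinger i.

Definition is_meridian (g : knot_group) := exists i h, g = wgen i ^ h.

Definition crossing_sign (b : bool) (g : knot_group) := if b then g else g^-1.

(* The parallel of the knot, read along one turn starting on the arc that leaves
   the under-passage of [c]: each under-passage contributes the over-generator
   to the power the sign of the crossing. Its linking number with the knot is
   the writhe, which [longitude] corrects by a power of the meridian. *)
Definition parallel c : knot_group :=
  \prod_(t < N.*2)
    let p := (next D ^+ t.+1) (c, false) in
    if p.2 then 1 else crossing_sign (positive D p.1) (wgen (over_arc p.1)).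

Definition longitude c : knot_group :=
  parallel c * \prod_(d < N) crossing_sign (~~ positive D d) (wgen (under_out c)).

(* Elements of the conjugates of the image of the fundamental group of the
   boundary torus, which is generated by a meridian and its longitude. *)
Inductive peripheral_at c : knot_group -> Prop :=
| PeriM : peripheral_at c (wgen (under_out c))
| PeriL : peripheral_at c (longitude c)
| Peri1 : peripheral_at c 1
| PeriMul g h : peripheral_at c g -> peripheral_at c h -> peripheral_at c (g * h)
| PeriV g : peripheral_at c g -> peripheral_at c g^-1.

Definition peripheral (g : knot_group) :=
  exists c h k, peripheral_at c h /\ g = h ^ k.

End Diagram.

Section SL2.

Local Open Scope ring_scope.

Record SL2 (C : fieldType) := MkSL2 { SL2mx :> 'M[C]_2; SL2_det : \det SL2mx == 1 }.

HB.instance Definition _ (C : fieldType) := [isSub for @SL2mx C].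
HB.instance Definition _ (C : fieldType) := [Choice of SL2 C by <:].

Variable C : fieldType.
Implicit Types A B : SL2 C.

Lemma SL2_unit A : SL2mx A \in unitmx.
Proof. by rewrite unitmxE (eqP (SL2_det A)) unitr1. Qed.

Fact SL2_one_det : \det (1%:M : 'M[C]_2) == 1.
Proof. by rewrite det1. Qed.
Fact SL2_mul_det A B : \det (A *m B) == 1.
Proof. by rewrite det_mulmx (eqP (SL2_det A)) (eqP (SL2_det B)) mulr1. Qed.
Fact SL2_inv_det A : \det (invmx A) == 1.
Proof. by rewrite det_inv (eqP (SL2_det A)) invr1. Qed.

Definition SL2_one := MkSL2 SL2_one_det.
Definition SL2_mul A B := MkSL2 (SL2_mul_det A B).
Definition SL2_inv A := MkSL2 (SL2_inv_det A).

Fact SL2_mulA : associative SL2_mul.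
Proof. by move=> A B E; apply/val_inj; rewrite /= mulmxA. Qed.
Fact SL2_mul1 : left_id SL2_one SL2_mul.
Proof. by move=> A; apply/val_inj; rewrite /= mul1mx. Qed.
Fact SL2_mulr1 : right_id SL2_one SL2_mul.
Proof. by move=> A; apply/val_inj; rewrite /= mulmx1. Qed.
Fact SL2_mulV : left_inverse SL2_one SL2_inv SL2_mul.
Proof. by move=> A; apply/val_inj; rewrite /= mulVmx ?SL2_unit. Qed.
Fact SL2_mulrV : right_inverse SL2_one SL2_inv SL2_mul.
Proof. by move=> A; apply/val_inj; rewrite /= mulmxV ?SL2_unit. Qed.

HB.instance Definition _ := isGroup.Build (SL2 C)
  SL2_mulA SL2_mul1 SL2_mulr1 SL2_mulV SL2_mulrV.

End SL2.

Section ArcColoring.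

Variable C : fieldType.

Local Open Scope ring_scope.

Definition Mmx (b : 'cV[C]_2) : 'M[C]_2 :=
  let x := b 0 0 in let y := b 1 0 in
  \matrix_(i, j)
    if i == 0 then (if j == 0 then 1 - x * y else x ^+ 2)
    else (if j == 0 then - y ^+ 2 else 1 + x * y).

Lemma det_mx2 (A : 'M[C]_2) : \det A = A 0 0 * A 1 1 - A 0 1 * A 1 0.
Proof.
have l0 : lift (0 : 'I_2) (0 : 'I_1) = 1 by exact/val_inj.
have l1 : lift (1 : 'I_2) (0 : 'I_1) = 0 by exact/val_inj.
rewrite (expand_det_row _ 0) big_ord_recl big_ord1 /cofactor !det_mx11 !mxE.
by rewrite l0 l1 expr0 expr1; ring.
Qed.

Lemma MmxE (b : 'cV[C]_2) i j : Mmx b i j =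
  if i == 0 then (if j == 0 then 1 - b 0 0 * b 1 0 else b 0 0 ^+ 2)
  else (if j == 0 then - b 1 0 ^+ 2 else 1 + b 0 0 * b 1 0).
Proof. by rewrite mxE. Qed.

Lemma Mmx_det (b : 'cV[C]_2) : \det (Mmx b) == 1.
Proof. by apply/eqP; rewrite det_mx2 !mxE /=; ring. Qed.

Definition M (b : 'cV[C]_2) : SL2 C := MkSL2 (Mmx_det b).

Definition rtri (a b : 'cV[C]_2) : 'cV[C]_2 := invmx (M b) *m a.
Definition ltri (a b : 'cV[C]_2) : 'cV[C]_2 := M b *m a.

Lemma ord2P (P : 'I_2 -> Prop) : P 0 -> P 1 -> forall i, P i.
Proof.
move=> P0 P1 [[|[|i]] // h].
  by rewrite (_ : Ordinal h = 0) //; exact/val_inj.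
by rewrite (_ : Ordinal h = 1) //; exact/val_inj.
Qed.

Lemma mulmx2E m n (A : 'M[C]_(m, 2)) (B : 'M[C]_(2, n)) i j :
  (A *m B) i j = A i 0 * B 0 j + A i 1 * B 1 j.
Proof.
rewrite mxE !big_ord_recl big_ord0 addr0.
by rewrite (_ : lift ord0 _ = 1) //; exact/val_inj.
Qed.

Lemma det_row2 (u v : 'cV[C]_2) :
  \det (row_mx u v : 'M[C]_2) = u 0 0 * v 1 0 - u 1 0 * v 0 0.
Proof.
have e0 k : row_mx u v k (0 : 'I_2) = u k 0.
  by rewrite -(row_mxEl u v k 0); congr (row_mx u v k _); exact/val_inj.
have e1 k : row_mx u v k (1 : 'I_2) = v k 0.
  by rewrite -(row_mxEr u v k 0); congr (row_mx u v k _); exact/val_inj.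
by rewrite det_mx2 !e0 !e1; ring.
Qed.

Lemma ltriE a b : ltri a b = a - \det (row_mx a b : 'M[C]_2) *: b.
Proof.
apply/matrixP => i j; rewrite ord1; move: i; apply: ord2P;
  by rewrite mulmx2E det_row2 !mxE /=; ring.
Qed.

Lemma rtriE a b : rtri a b = a + \det (row_mx a b : 'M[C]_2) *: b.
Proof.
apply: (can_inj (mulKmx (SL2_unit (M b)))).
rewrite /rtri mulKVmx ?SL2_unit //.
apply/matrixP => i j; rewrite ord1; move: i; apply: ord2P;
  by rewrite mulmx2E det_row2 !mxE /=; ring.
Qed.

Lemma M_conj (S : SL2 C) b : M (SL2mx S *m b) = (S * M b * S^-1)%g.
Proof.
apply: (@mulIg _ S); rewrite mulgVK; apply/val_inj => /=.
apply/matrixP; have := eqP (SL2_det S); rewrite det_mx2.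
move: (SL2mx S) => {}S; set d := _ - _ => d1.
have dE : S 0 0 * S 1 1 = 1 + S 0 1 * S 1 0 by rewrite -d1 /d; ring.
by apply: ord2P; apply: ord2P; rewrite !(mulmx2E, MmxE) /= ?mulmx2E; ring: dE.
Qed.

Lemma M_opp b : M (- b) = M b.
Proof.
by apply/val_inj/matrixP; apply: ord2P; apply: ord2P; rewrite !mxE /=; ring.
Qed.

Variables (N : nat) (D : diagram N).

Definition arc_coloring (eps : 'I_N -> int) (a : 'I_N -> 'cV[C]_2) : Prop :=
  (forall n, eps n = 1 \/ eps n = -1) /\
  (forall n, a (under_out D n) *~ eps n =
     if positive D n then rtri (a (under_in D n)) (a (over_arc D n))
     else ltri (a (under_in D n)) (a (over_arc D n))).

Lemma arc_coloring_respects eps a :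
  arc_coloring eps a -> respects (M \o a) (wirtinger D).
Proof.
move=> [epsP aP] _ _ [c [-> ->]].
have -> : weval (M \o a) [:: (under_out D c, true)] = M (a (under_out D c) *~ eps c).
  rewrite /weval big_seq1 /=; case: (epsP c) => -> //.
  by rewrite mulrNz M_opp.
rewrite aP /weval; case: ifP => _; rewrite !big_cons big_nil /= mulg1 mulgA.
  by rewrite [rtri _ _]/(SL2mx (M (a (over_arc D c)))^-1%g *m _) M_conj invgK.
by rewrite M_conj.
Qed.

Definition assoc_rep eps a (ha : arc_coloring eps a) : knot_group D -> SL2 C :=
  plift (arc_coloring_respects ha).

HB.instance Definition _ eps a (ha : arc_coloring eps a) :=
  UMagmaMorphism.on (assoc_rep ha).

Lemma assoc_rep_gen eps a (ha : arc_coloring eps a) i :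
  assoc_rep ha (wgen D i) = M (a i).
Proof. exact: plift_gen. Qed.

Implicit Type rho : {multiplicative knot_group D -> SL2 C}.

Definition parabolic rho : Prop :=
  (exists g h, rho g * rho h <> rho h * rho g)%g /\
  (forall m, is_meridian m -> \tr (rho m) = 2 /\ rho m <> 1%g).

(* [rho'] lifts the PSL_2-representation induced by [rho]: they agree up to sign. *)
Definition lifts_PSL2 rho rho' : Prop :=
  forall g, SL2mx (rho' g) = rho g \/ SL2mx (rho' g) = - SL2mx (rho g).

Definition boundary_unipotent rho : Prop :=
  forall g, peripheral g -> \tr (rho g) = 2.

(* The class lives in a group of order 2, written {1, -1}; it is trivial
   iff a boundary-unipotent lift exists. *)
Definition obstruction rho : int :=
  if `[< exists rho', lifts_PSL2 rho rho' /\ boundary_unipotent rho' >] then 1 else -1.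

End ArcColoring.

(* Main.v *)
(* At every passage the relation of the arc-coloring reads
   [rho g *m a_out = eps a_in], where [g] is the letter that the passage
   contributes to the parallel. Multiplying these along one turn of the knot
   shows that the color of the starting arc is an eigenvector of
   [rho (parallel c)], hence of [rho (longitude c)], with eigenvalue the
   product of all the signs; in [SL2] this determines the trace. A lift which
   is unipotent on meridians agrees with [rho] on the Wirtinger generators,
   hence everywhere, so that [rho] itself decides the obstruction. *)
Require Import Defs.
From HB Require Import structures.
From mathcomp Require Import all_boot all_order all_algebra all_fingroup.
From mathcomp Require Import boolp reals complex ring.

Set Implicit Arguments.
Unset Strict Implicit.
Unset Printing Implicit Defensive.

Import GRing.Theory Num.Theory.

Local Open Scope ring_scope.

(** * Permutations with a single cycle *)

Section Cycle.

Variables (T : finType) (s : {perm T}).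
Hypothesis s_cycle : forall p q, fconnect s p q.

Lemma cycle_order p : fingraph.order s p = #|T|.
Proof. by apply: eq_card => q; rewrite inE; exact: s_cycle. Qed.

Lemma cycle_expg_card p : (s ^+ #|T|)%g p = p.
Proof. by rewrite permX -(cycle_order p) iter_order //; exact: perm_inj. Qed.

Lemma prod_cycle (A : comPzRingType) (F : T -> A) p :
  \prod_(t < #|T|) F ((s ^+ t.+1)%g p) = \prod_q F q.
Proof.
(* The exponents start at 1 while the orbit starts at [p] itself; reindexing by [s] absorbs this
   shift. *)
rewrite [RHS](reindex_inj (@perm_inj _ s)) /=.
transitivity (\prod_(q <- fingraph.orbit s p) F (s q)).
  rewrite (big_nth p) size_orbit cycle_order big_mkord.
  apply: eq_bigr => t _; rewrite expgSr permM permX nth_traject //.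
  by rewrite cycle_order.
rewrite [RHS](eq_bigl (mem (fingraph.orbit s p))) => [|q].
  by rewrite -big_uniq ?orbit_uniq //=.
by rewrite /= -fconnect_orbit s_cycle.
Qed.

End Cycle.

(** * Eigenvectors and traces in [SL2] *)

Section SL2Trace.

Variable C : fieldType.

Lemma mxtrace2 (A : 'M[C]_2) : \tr A = A 0 0 + A 1 1.
Proof.
rewrite /mxtrace !big_ord_recl big_ord0 addr0.
by rewrite (_ : lift ord0 _ = 1) //; exact/val_inj.
Qed.

(** Since [z] is its own inverse, both [A] and its inverse multiply [v] by [z]; by Cayley-Hamilton
    their sum is the scalar [\tr A]. *)
Lemma SL2_trace_eigenvector (A : SL2 C) (v : 'cV[C]_2) (z : C) :
  v != 0 -> z * z = 1 -> SL2mx A *m v = z *: v -> \tr A = z *+ 2.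
Proof.
move=> v0 zz Av; have := eqP (SL2_det A).
move: (SL2mx A) Av => {}A Av; rewrite det_mx2 mxtrace2 => dA.
have E i : A i 0 * v 0 0 + A i 1 * v 1 0 = z * v i 0.
  by rewrite -mulmx2E Av mxE.
apply/eqP; rewrite -subr_eq0; move: v0; apply: contra_neqT => tr0.
have solve i : (A 0 0 + A 1 1) * v i 0 = z *+ 2 * v i 0 -> v i 0 = 0.
  move/eqP; rewrite -subr_eq0 -mulrBl mulf_eq0 (negPf tr0) /=.
  by move/eqP.
apply/matrixP => i j; rewrite ord1 mxE; apply: solve; move: i; apply: ord2P.
  (* This is a coordinate of [A v + z adj(A) (z v)]; replacing [z v] by [A v] makes the determinant
     appear. *)
  transitivity (A 0 0 * v 0 0 + A 0 1 * v 1 0 +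
      z * (A 1 1 * (z * v 0 0) - A 0 1 * (z * v 1 0))); first by ring: zz.
  rewrite -(E 0) -(E 1).
  transitivity (A 0 0 * v 0 0 + A 0 1 * v 1 0 +
      z * ((A 0 0 * A 1 1 - A 0 1 * A 1 0) * v 0 0)); first by ring.
  by rewrite dA E; ring.
transitivity (A 1 0 * v 0 0 + A 1 1 * v 1 0 +
    z * (A 0 0 * (z * v 1 0) - A 1 0 * (z * v 0 0))); first by ring: zz.
rewrite -(E 0) -(E 1).
transitivity (A 1 0 * v 0 0 + A 1 1 * v 1 0 +
    z * ((A 0 0 * A 1 1 - A 0 1 * A 1 0) * v 1 0)); first by ring.
by rewrite dA E; ring.
Qed.

Lemma M_fix (b : 'cV[C]_2) : SL2mx (M b) *m b = b.
Proof. by rewrite [LHS]ltriE det_row2 mulrC subrr scale0r subr0. Qed.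

Lemma trace_M (b : 'cV[C]_2) : \tr (M b) = 2.
Proof. by rewrite mxtrace2 !MmxE /=; ring. Qed.

Lemma M0 : M (0 : 'cV[C]_2) = 1%g.
Proof.
by apply/val_inj/matrixP; apply: ord2P; apply: ord2P; rewrite !mxE /=; ring.
Qed.

Lemma SL2_trace_conj (A B : SL2 C) : \tr (A ^ B)%g = \tr A.
Proof.
rewrite conjgE /= mxtrace_mulC -mulmxA.
by rewrite mulmxV ?SL2_unit // mulmx1.
Qed.

Lemma SL2_inv_fix (A : SL2 C) (v : 'cV[C]_2) :
  SL2mx A *m v = v -> SL2mx A^-1%g *m v = v.
Proof. by move=> Av; rewrite -{1}Av mulKmx ?SL2_unit. Qed.

End SL2Trace.

(* [{multiplicative G -> H}] only asks for products to be preserved, so that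
   [gmulf1] and [gmulfV] do not apply to it. *)
Lemma multiplicative1 (G H : groupType) (f : {multiplicative G -> H}) :
  f 1%g = 1%g.
Proof. by apply: (@mulIg _ (f 1%g)); rewrite -gmulfM !mul1g. Qed.

Lemma multiplicativeV (G H : groupType) (f : {multiplicative G -> H}) x :
  f x^-1%g = (f x)^-1%g.
Proof.
by apply: (@mulIg _ (f x)); rewrite -gmulfM !mulVg multiplicative1.
Qed.

Lemma presented_morph_ext (I : choiceType)
    (r : seq (I * bool) -> seq (I * bool) -> Prop) (H : groupType)
    (f g : {multiplicative presented r -> H}) :
  (forall i, f (pgen r i) = g (pgen r i)) -> f =1 g.
Proof.
move=> fg x; rewrite -[x]wclass_repr.
elim: (generic_quotient.repr x) => [|[i b] w IH].
  by rewrite [wclass r [::]]/(1%g : presented r) !multiplicative1.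
rewrite -cat1s -pmulE [pmul _ _]/(wclass r _ * wclass r w)%g !gmulfM IH.
congr (_ * _)%g; case: b; first exact: fg.
have := congr1 (@invg H) (fg i).
by rewrite -!multiplicativeV [(pgen r i)^-1%g]pinvE.
Qed.

(** * Transport of colors along the knot *)

Section Coloring.

Variables (C : fieldType) (N : nat) (D : diagram N).
Variables (eps : 'I_N -> int) (a : 'I_N -> 'cV[C]_2).
Hypothesis ha : arc_coloring D eps a.

Local Notation rho := (assoc_rep ha).

Definition passage_letter (p : 'I_N * bool) : knot_group D :=
  if p.2 then 1%g else crossing_sign (positive D p.1) (wgen D (over_arc D p.1)).

Definition passage_sign (p : 'I_N * bool) : int := if p.2 then 1 else eps p.1.

Lemma sign_sqr c : eps c * eps c = 1.
Proof. by have [/(_ c) [] ->] := ha. Qed.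

Lemma passage_color p :
  SL2mx (rho (passage_letter p)) *m a (Defs.arc D p) =
  (passage_sign p)%:~R *: a (Defs.arc D ((Defs.next D)^-1%g p)).
Proof.
case: p => c [] /=.
  by rewrite /passage_letter /= gmulf1 mul1mx scale1r -arc_over.
rewrite /passage_letter /passage_sign /crossing_sign /=.
(* As [eps c] squares to 1, multiplying by it moves the sign to the side of the incoming arc. *)
have [_ /(_ c) /(congr1 ( *~%R ^~ (eps c)))] := ha.
rewrite -mulrzA sign_sqr mulr1z -/(under_out D c) -/(under_in D c) => ->.
rewrite -!scaler_int -scalemxAr; congr (_ *: _).
case: positive => /=; first by rewrite assoc_rep_gen mulKVmx ?SL2_unit.
by rewrite gmulfV /= assoc_rep_gen mulKmx ?SL2_unit.
Qed.

Lemma turn_color n p :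
  SL2mx (rho (\prod_(t < n) passage_letter ((Defs.next D ^+ t.+1)%g p))%g)
    *m a (Defs.arc D ((Defs.next D ^+ n)%g p)) =
  (\prod_(t < n) passage_sign ((Defs.next D ^+ t.+1)%g p))%:~R *: a (Defs.arc D p).
Proof.
elim: n => [|n IH]; first by rewrite !big_ord0 gmulf1 mul1mx perm1 scale1r.
(* The last letter acts first and brings the color back by one passage. *)
rewrite !big_ord_recr /= gmulfM /= -mulmxA passage_color expgSr permM permK.
by rewrite -scalemxAr IH scalerA intrM mulrC.
Qed.

Let total : C := (\prod_(n < N) eps n)%:~R.

Lemma card_passages : N.*2 = #|{: 'I_N * bool}|.
Proof. by rewrite card_prod card_ord card_bool muln2. Qed.

Lemma prod_passage_sign : \prod_p passage_sign p = \prod_(n < N) eps n.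
Proof.
rewrite -(pair_bigA _ (fun c b => passage_sign (c, b))) /=.
by apply: eq_bigr => c _; rewrite big_bool /= mul1r.
Qed.

Lemma parallel_color c :
  SL2mx (rho (parallel D c)) *m a (under_out D c) = total *: a (under_out D c).
Proof.
have := turn_color N.*2 (c, false).
have -> : (Defs.next D ^+ N.*2)%g (c, false) = (c, false).
  by rewrite card_passages cycle_expg_card //; exact: Defs.next_cycle.
suff -> : \prod_(t < N.*2) passage_sign ((Defs.next D ^+ t.+1)%g (c, false)) =
  \prod_(n < N) eps n by [].
rewrite card_passages (prod_cycle _ passage_sign); last exact: Defs.next_cycle.
exact: prod_passage_sign.
Qed.

(** The writhe correction is a power of the meridian of the starting arc, whose image fixes the
    color of that arc. *)
Lemma longitude_color c :
  SL2mx (rho (longitude D c)) *m a (under_out D c) = total *: a (under_out D c).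
Proof.
rewrite /longitude /crossing_sign gmulfM /= -mulmxA -[RHS]parallel_color; congr (_ *m _).
rewrite gmulf_prod; elim/big_rec: _ => [|d A _ IH]; first by rewrite mul1mx.
rewrite /= -mulmxA IH; case: positive => /=.
  by rewrite gmulfV /= assoc_rep_gen SL2_inv_fix ?M_fix.
by rewrite assoc_rep_gen M_fix.
Qed.

Lemma prod_sign_sqr : (\prod_(n < N) eps n) * \prod_(n < N) eps n = 1.
Proof. by rewrite -big_split big1 //= => c _; exact: sign_sqr. Qed.

Lemma total_sqr : total * total = 1.
Proof. by rewrite -intrM prod_sign_sqr. Qed.

Lemma trace_longitude c :
  a (under_out D c) != 0 -> \tr (rho (longitude D c)) = total *+ 2.
Proof. by move=> a0; exact: SL2_trace_eigenvector a0 total_sqr (longitude_color c). Qed.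

Lemma peripheral_color c g :
  total = 1 -> peripheral_at c g ->
  SL2mx (rho g) *m a (under_out D c) = a (under_out D c).
Proof.
move=> t1; elim=> {g}.
- by rewrite assoc_rep_gen M_fix.
- by rewrite longitude_color t1 scale1r.
- by rewrite gmulf1 mul1mx.
- by move=> g h _ IHg _ IHh; rewrite gmulfM /= -mulmxA IHh.
- by move=> g _ IH; rewrite gmulfV SL2_inv_fix.
Qed.

Hypothesis hpar : parabolic (assoc_rep ha).

Lemma parabolic_color_neq0 i : a i != 0.
Proof.
apply/eqP => ai0; case: hpar => _ /(_ (wgen D i)) [].
  by exists i, 1%g; rewrite conjg1.
by have := assoc_rep_gen ha i; rewrite ai0 M0 => e _ /(_ e).
Qed.

Lemma assoc_rep_boundary_unipotent :
  total = 1 -> boundary_unipotent (assoc_rep ha).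
Proof.
move=> t1 _ [c [h [k [ch ->]]]]; rewrite gmulfJ SL2_trace_conj.
apply: (SL2_trace_eigenvector (parabolic_color_neq0 (under_out D c)) (mulr1 1)).
by rewrite scale1r peripheral_color.
Qed.

(** By finiteness the injection [arc_under] is onto: every arc leaves some under-passage. *)
Lemma peripheral_wgen i : peripheral (wgen D i).
Proof.
have [f _ fK] := injF_bij (@arc_under _ D).
exists (f i), (wgen D i), 1%g; rewrite conjg1; split=> //.
by rewrite -{2}(fK i); exact: PeriM.
Qed.

Lemma unipotent_lift_eq rho' : (2 : C) != 0 ->
  lifts_PSL2 (assoc_rep ha) rho' -> boundary_unipotent rho' ->
  rho' =1 assoc_rep ha.
Proof.
move=> two0 lift unip; apply: presented_morph_ext => i.
apply/val_inj => /=; case: (lift (wgen D i)) => // E.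
have {}E : SL2mx (rho' (wgen D i)) = - SL2mx (M (a i)).
  by rewrite E -(assoc_rep_gen ha i).
(* The opposite sign would give [-2 = 2], hence [2 * 2 = 0]. *)
have := unip _ (peripheral_wgen i); rewrite E linearN /= trace_M => /eqP.
rewrite eq_sym -subr_eq0 opprK -natrD (_ : (2 + 2 = 2 * 2)%N) // natrM mulf_eq0.
by rewrite (negPf two0).
Qed.

End Coloring.

Theorem theorem3p8 (R : realType) (N : nat) (D : diagram N)
    (eps : 'I_N -> int) (a : 'I_N -> 'cV[complex R]_2)
    (ha : arc_coloring D eps a) (hpar : parabolic (assoc_rep ha)) :
  obstruction (assoc_rep ha) = \prod_(n < N) eps n.
Proof.
rewrite /obstruction; case: asboolP => [[rho' [lift unip]]|no_lift].
  (* A longitude needs a crossing to start from; without crossings the product of signs is empty. *)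
  case: N D eps a ha hpar rho' lift unip => [|N] D eps a ha hpar rho' lift unip.
    by rewrite big_ord0.
  have two0 : (2 : complex R) != 0 by rewrite pnatr_eq0.
  have perL : peripheral (longitude D ord0).
    by exists ord0, (longitude D ord0), 1%g; rewrite conjg1; split=> //; exact: PeriL.
  have := unip _ perL; rewrite (unipotent_lift_eq two0 lift unip).
  rewrite (trace_longitude ha (parabolic_color_neq0 hpar _)) => /eqP.
  (* The longitude has trace both 2 and twice the total sign; cancel 2 and return to the
     integers. *)
  rewrite -subr_eq0 -mulrnBl -mulr_natr mulf_eq0 (negPf two0) orbF subr_eq0.
  by move/eqP/(@intr_inj (complex R) _ 1).
(* The total sign is 1 or -1; were it 1, the representation would be a boundary-unipotent lift of
   itself. *)
have /eqP := prod_sign_sqr ha; rewrite -expr2 sqrf_eq1.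
case/orP => /eqP e1; last by rewrite e1.
case: no_lift; exists (assoc_rep ha); split.
  by move=> g; left.
by apply: assoc_rep_boundary_unipotent; rewrite ?e1.
Qed.
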